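(* There exist a Tychonoff cut-point space $X$ and a point $x\in X$ such that $x$ is a cut point of every compactification of $X$; that is, for every compact Hausdorff space $K$ and every homeomorphic embedding $e:X\to K$ with $e[X]$ dense in $K$, the point $e(x)$ is a cut point of $K$.
   Context: A point $x$ of a connected space $Z$ is a cut point of $Z$ if $Z\setminus\{x\}$ is disconnected. A cut-point space is a connected topological space in which every point is a cut point. A compactification of a Tychonoff space $X$ is a compact Hausdorff space which has a dense subspace homeomorphic to $X$. *)

(* Defs.v *)
From mathcomp Require Import all_boot all_order all_algebra.
From mathcomp Require Import all_classical all_reals all_analysis.

Set Implicit Arguments.
Unset Strict Implicit.
Unset Printing Implicit Defensive.

Local Open Scope classical_set_scope.

(* The library phrases complete regularity through uniform separators; by
   uniform_separatorP these amount to separation of points from closed sets by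
   continuous functions into [0, 1]. *)
Definition tychonoff_space (X : topologicalType) : Prop :=
  completely_regular_space X /\ hausdorff_space X.

(* Cut points are only defined in connected spaces, hence the first conjunct. *)
Definition cut_point (Z : topologicalType) (x : Z) : Prop :=
  connected [set: Z] /\ ~ connected (~` [set x]).

Definition cut_point_space (Z : topologicalType) : Prop :=
  connected [set: Z] /\ forall x : Z, cut_point x.

(* A homeomorphism onto the subspace [range e]: images of open sets are only
   required to be open relatively to the range. *)
Definition topological_embedding (X K : topologicalType) (e : X -> K) : Prop :=
  [/\ injective e, continuous e &
      forall U : set X, open U -> open (e @` U : set (subspace (range e)))].

(* A compactification is a space K together with the embedding e witnessing
   that X is homeomorphic to a dense subspace of K. *)
Definition compactification (X K : topologicalType) (e : X -> K) : Prop :=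
  [/\ compact [set: K], hausdorff_space K, topological_embedding e &
      dense (range e)].

(* Main.v *)
(* Let X be the union of the coordinate axes in the product R^I, with I
   uncountable, and x = 0. Every neighbourhood of 0 contains all but finitely
   many axes. In a compactification K, what an axis acquires in its closure stays
   away from 0, so that closure meets only finitely many of the closures of the
   other axes outside 0. Hence the axes reached from a given one by chains of such
   meetings are only countably many. Because the axes shrink to 0, the closure of
   their union and the closure of the union of the remaining axes meet only in 0,
   and these two sets cover K. *)

Require Import Defs.
From mathcomp Require Import all_boot all_order all_algebra.
From mathcomp Require Import all_classical all_reals all_analysis.
From mathcomp Require Import Rstruct.

Set Implicit Arguments.
Unset Strict Implicit.
Unset Printing Implicit Defensive.

Import Order.TTheory GRing.Theory Num.Theory numFieldNormedType.Exports.
Local Open Scope classical_set_scope.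
Local Open Scope ring_scope.

(** * Families of sets converging to a point along the cofinite filter *)

Definition shrinking_to (T : topologicalType) (I : Type) (B : I -> set T)
    (p : T) : Prop :=
  forall W, nbhs p W -> finite_set [set i | ~ B i `<=` W].

Lemma shrinking_to_image (X T : topologicalType) (I : Type) (A : I -> set X)
    (o : X) (f : X -> T) :
  {for o, continuous f} -> shrinking_to A o ->
  shrinking_to (fun i => f @` A i) (f o).
Proof.
move=> cf shA W /cf/= fW; apply: sub_finite_set (shA _ fW) => i /=.
by apply: contra_not => AW _ [x Ax <-]; exact: AW.
Qed.

Lemma shrinking_to_closure (T : topologicalType) (I : Type) (B : I -> set T)
    (p : T) :
  {for p, regular_space T} -> shrinking_to B p ->
  shrinking_to (fun i => closure (B i)) p.
Proof.
move=> reg shB W /reg[V nV VW]; apply: sub_finite_set (shB _ nV) => i /=.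
by apply: contra_not => BV; apply: subset_trans VW; exact: closureS.
Qed.

(** Separate [y] from [p] by disjoint open [V] and [W]: all but finitely many [B i] lie in [W],
    hence miss [V]. Near [y] only a finite union matters, and closure commutes with finite
    unions. *)
Lemma closure_bigcup_shrinking (T : topologicalType) (I : choiceType)
    (B : I -> set T) (p y : T) (D : set I) :
  hausdorff_space T -> shrinking_to B p -> y <> p ->
  closure (\bigcup_(i in D) B i) y -> exists2 i, D i & closure (B i) y.
Proof.
rewrite open_hausdorff => hT shB /eqP/hT[[V W]]/= [].
move=> /set_mem Vy /set_mem Wp [oV oW /eqP VW] clDy.
have nW : nbhs p W by apply: open_nbhs_nbhs.
have finD : finite_set (D `&` [set i | ~ B i `<=` W]).
  by apply: sub_finite_set (shB _ nW) => i [].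
have cF : closed (\bigcup_(i in D `&` [set i | ~ B i `<=` W]) closure (B i)).
  by apply: closed_bigcup => // i _; exact: closed_closure.
have cV : closed (~` V) by exact: open_closedC.
have : closure (\bigcup_(i in D `&` [set i | ~ B i `<=` W]) closure (B i)
                `|` ~` V) y.
  apply: closureS clDy => x [i Di Bx].
  have [BW|nBW] := pselect (B i `<=` W); last first.
    by left; exists i => //; exact: subset_closure.
  right=> Vx; have : (V `&` W) x by split=> //; exact: BW.
  by rewrite VW.
rewrite closureU -(closure_id _).1// -(closure_id _).1// => -[|//].
by move=> [i [Di _] cBy]; exists i.
Qed.

Lemma countable_rel_closed (I : Type) (r : I -> I -> Prop) (i0 : I) :
  (forall i, countable [set j | r i j]) ->
  exists S : set I,
    [/\ S i0, countable S & forall i j, S i -> r i j -> S j].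
Proof.
move=> cr.
(* [S_ n] collects the indices reached from [i0] by chains of exactly [n] steps. *)
pose S_ n := iter n (fun S : set I => \bigcup_(i in S) [set j | r i j]) [set i0].
exists (\bigcup_n S_ n); split.
- by exists 0%N.
- apply: bigcup_countable => // n _; elim: n => [|n IH]; first exact: countable1.
  exact: bigcup_countable.
- by move=> i j [n _ Sni] rij; exists n.+1 => //; exists i.
Qed.

(** * Closures of embedded sets in a compactification *)

Lemma embedding_openP (X K : topologicalType) (e : X -> K) (U : set X) :
  topological_embedding e -> open U -> exists2 W, open W & e @^-1` W = U.
Proof.
move=> [inj_e _ op_e] /op_e/open_subspaceP[W oW WU]; exists W => //.
apply/seteqP; split=> x /= Hx.
  have : (W `&` range e) (e x) by split=> //; exists x.
  by rewrite WU => -[[z Uz /inj_e <-]].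
have : (e @` U `&` range e) (e x) by split; exists x.
by rewrite -WU => -[].
Qed.

Lemma embedding_closureN (X K : topologicalType) (e : X -> K) (U B : set X)
    (x : X) :
  topological_embedding e -> open U -> U x -> B `&` U = set0 ->
  ~ closure (e @` B) (e x).
Proof.
move=> emb oU Ux BU0; have [W oW WU] := embedding_openP emb oU.
have nW : nbhs (e x) W.
  by apply: open_nbhs_nbhs; split=> //; move: Ux; rewrite -WU.
move=> /(_ _ nW)[_ [[z Bz <-] Wz]].
have : (B `&` U) z by split=> //; rewrite -WU.
by rewrite BU0.
Qed.

(** The point [p] is excluded because the closures of all axes share it. *)
Definition linked (T : topologicalType) (I : Type) (B : I -> set T) (p : T)
    (i j : I) : Prop :=
  exists y, [/\ y <> p, closure (B i) y & closure (B j) y].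

(** The closure of [e @] A i[splits into two pieces:]e @[C], already closed by compactness, and the
    closure of [e @] (A i [\] U)[, which avoids]e o[. The first meets no closure of another]e @[A j]
    outside [e o], since [A i] is open and disjoint from [A j]. The second meets only finitely many,
    since the closures shrink to [e o]. *)
Lemma finite_linked (X K : topologicalType) (I : choiceType) (A : I -> set X)
    (o : X) (e : X -> K) (i : I) (U C : set X) :
  compactification e -> shrinking_to A o ->
  (forall k, open (A k)) -> (forall k l, k <> l -> A l `&` A k = set0) ->
  open U -> U o -> compact C -> A i `&` U `<=` C -> C `<=` A i `|` [set o] ->
  finite_set [set j | linked (fun k => e @` A k) (e o) i j].
Proof.
move=> [cK hK emb _] shA oA dA oU Uo cC AUC CA.
have [_ ce _] := emb.
have reg : {for e o, regular_space K} by apply: compact_regular cK filterT.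
have shF := shrinking_to_closure reg (shrinking_to_image (ce o) shA).
have clC : closed (e @` C).
  apply: compact_closed => //; apply: continuous_compact => //.
  exact: continuous_subspaceT.
have nT : nbhs (e o) (~` closure (e @` (A i `\` U))).
  apply: open_nbhs_nbhs; split; first exact/closed_openC/closed_closure.
  by apply: embedding_closureN Uo _ => //; rewrite setDE -setIA setICl setI0.
apply: (@sub_finite_set _ _ ([set i] `|` _)); last first.
  by rewrite finite_setU; split; [exact: finite_set1|exact: shF nT].
move=> j [y [yo Fiy Fjy]] /=.
have [->|/eqP ji] := eqVneq j i; [by left|right=> FjT].
have : closure (e @` C `|` e @` (A i `\` U)) y.
  apply: closureS Fiy => _ [x Ax <-].
  have [Ux|nUx] := pselect (U x); last by right; exists x.
  by left; exists x => //; exact: AUC.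
rewrite closureU -(closure_id _).1// => -[[c Cc cy]|]; last exact: FjT Fjy.
subst y; case: (CA _ Cc) => [Ac|co]; last by apply: yo; rewrite co.
exact: (embedding_closureN emb (oA i) Ac (dA _ _ (not_eq_sym ji))).
Qed.

(** * Producing cut points of a compactification *)

Lemma cut_point_closed_cover (Z : topologicalType) (p a b : Z) (C D : set Z) :
  connected [set: Z] -> closed C -> closed D -> C a -> D b -> a <> p -> b <> p ->
  ~` [set p] `<=` C `|` D -> C `&` D `<=` [set p] -> cut_point p.
Proof.
move=> cZ cC cD Ca Db ap bp CD CDp; split=> // cp.
(* Off [p], the set [C] is the complement of [D], hence clopen and nonempty; connectedness would
   make it everything, putting [b] in both [C] and [D]. *)
suff /seteqP[_ /(_ _ bp)[_ Cb]] : ~` [set p] `&` C = ~` [set p].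
  by apply: bp; exact: CDp.
apply: cp.
- by exists a.
- exists (~` D); first exact: closed_openC.
  apply/seteqP; split=> y [yp Hy]; split=> //.
    by move=> Dy; apply: yp; exact: CDp.
  by case: (CD _ yp).
- by exists C.
Qed.

Lemma compactification_connected (X K : topologicalType) (e : X -> K) :
  connected [set: X] -> compactification e -> connected [set: K].
Proof.
move=> cX [_ _ [_ ce _] de].
suff -> : [set: K] = closure (range e).
  apply: connected_closure; apply: connected_continuous_connected => //.
  exact: continuous_subspaceT.
apply/seteqP; split=> // y _ W; rewrite nbhsE => -[V [oV Vy] VW].
have [] := de V _ oV; first by exists y.
by move=> z [Vz ez]; exists z; split=> //; exact: VW.
Qed.

(** The argument in abstract form. The hypothesis providing [U] and [C] expresses local compactness
    of [A i]|[[set o]] at [o]. *)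
Lemma cut_point_compactification (X K : topologicalType) (I : choiceType)
    (A : I -> set X) (o : X) (e : X -> K) :
  connected [set: X] -> ~ countable [set: I] ->
  shrinking_to A o -> (forall i, open (A i)) -> (forall i, A i !=set0) ->
  (forall i j, i <> j -> A j `&` A i = set0) ->
  ~` [set o] = \bigcup_i A i ->
  (forall i, exists U C, [/\ open U, U o, compact C,
     A i `&` U `<=` C & C `<=` A i `|` [set o]]) ->
  compactification e -> cut_point (e o).
Proof.
move=> cX ucI shA oA A0 dA AE lcA cpt.
have [_ hK emb de] := cpt.
have [inj_e ce _] := emb.
have [i0 _] : [set: I] !=set0.
  apply/set0P/negP => /eqP I0; apply: ucI; rewrite I0; exact: countable0.
pose B i := e @` A i.
have shB : shrinking_to B (e o) by exact: shrinking_to_image (ce o) shA.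
have [|S [Si0 cS Sr]] := @countable_rel_closed I (linked B (e o)) i0.
  move=> i; have [U [C [oU Uo cC AUC CA]]] := lcA i.
  by apply: finite_set_countable; apply: finite_linked AUC CA.
(* A countable [S] cannot exhaust [I]; the index [j] makes the second side nontrivial. *)
have [j Sj] : exists j, ~ S j.
  apply/existsNP => allS; apply: ucI; apply: sub_countable cS.
  by apply: subset_card_le => i _; exact: allS.
have eNo i x : A i x -> e x <> e o.
  by move=> Ax /inj_e xo; have : (\bigcup_i A i) x; [exists i|rewrite -AE].
have [[a Aa] [b Ab]] := (A0 i0, A0 j).
apply: (@cut_point_closed_cover K (e o) (e a) (e b)
  (closure (\bigcup_(i in S) B i)) (closure (\bigcup_(i in ~` S) B i))).
- exact: compactification_connected cpt.
- exact: closed_closure.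
- exact: closed_closure.
- by apply: subset_closure; exists i0 => //; exists a.
- by apply: subset_closure; exists j => //; exists b.
- exact: eNo Aa.
- exact: eNo Ab.
- move=> y yo.
  (* The three pieces together make up the dense set [range e]. *)
  suff : closure (\bigcup_(i in S) B i `|` \bigcup_(i in ~` S) B i `|` [set e o]) y.
    rewrite closureU closureU => -[//|]; rewrite -(closure_id _).1//.
    exact/accessible_closed_set1/hausdorff_accessible.
  move=> W; rewrite nbhsE => -[V [oV Vy] VW].
  have [] := de V _ oV; first by exists y.
  move=> _ [/[swap] [[x _ <-]] Vx]; exists (e x); split; last exact: VW.
  have [->|xo] := pselect (x = o); first by right.
  have : (~` [set o]) x by [].
  rewrite AE => -[i _ Ax]; left.
  by have [Si|Si] := pselect (S i); [left|right]; exists i => //; exists x.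
- move=> y [Cy Dy]; apply: contrapT => yo.
  have [i Si Fi] := closure_bigcup_shrinking hK shB yo Cy.
  have [k Sk Fk] := closure_bigcup_shrinking hK shB yo Dy.
  (* The point [y] links [i] in [S] to [k] outside [S], against the closedness of [S] under
     links. *)
  by apply: Sk; apply: Sr Si _; exists y.
Qed.

(** * The union of the coordinate axes, as functions with at most one nonzero value *)

Definition axes (I : choiceType) (R : realType) : set {ptws I -> R} :=
  [set f | forall i j, f i != 0 -> f j != 0 -> i = j].
Arguments axes : clear implicits.

Definition coord (I : choiceType) (R : realType) (i : I) (x : axes I R) : R :=
  set_val x i.

Lemma axis_point_subproof (I : choiceType) (R : realType) (i : I) (t : R) :
  (dfwith (fun=> 0) i t : {ptws I -> R}) \in axes I R.
Proof.
apply: mem_set => j k /=.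
have [<-|ij] := eqVneq i j; last by rewrite dfwithout ?eqxx.
by have [<-|ik] := eqVneq i k; last by rewrite (dfwithout _ _ ik) eqxx.
Qed.

Definition axis_point (I : choiceType) (R : realType) (i : I) (t : R) :
  axes I R := exist (fun f => f \in axes I R) _ (axis_point_subproof i t).

Lemma coord_axis_point (I : choiceType) (R : realType) (i : I) (t : R) :
  coord i (axis_point i t) = t.
Proof. by rewrite /coord set_valE /= dfwithin. Qed.

Lemma coord_axis_pointN (I : choiceType) (R : realType) (i j : I) (t : R) :
  i != j -> coord j (axis_point i t) = 0.
Proof. by move=> ij; rewrite /coord set_valE /= dfwithout. Qed.

Lemma coord_inj (I : choiceType) (R : realType) (x y : axes I R) :
  (forall i, coord i x = coord i y) -> x = y.
Proof. by move=> xy; apply: val_inj; apply/funext => i; exact: xy. Qed.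

Lemma coord_neq0 (I : choiceType) (R : realType) (x : axes I R) (i j : I) :
  coord i x != 0 -> i != j -> coord j x = 0.
Proof.
move=> xi ij; apply/eqP; apply: contraT => xj.
by move/eqP: ij; case; apply: (set_valP x i j).
Qed.

Lemma axis_pointE (I : choiceType) (R : realType) (x : axes I R) (i : I) :
  coord i x != 0 -> x = axis_point i (coord i x).
Proof.
move=> xi; apply: coord_inj => j; have [<-|ij] := eqVneq i j.
  by rewrite coord_axis_point.
by rewrite coord_axis_pointN// (coord_neq0 xi).
Qed.

Lemma continuous_coord (I : choiceType) (R : realType) (i : I) :
  continuous (coord i : axes I R -> R).
Proof.
move=> x; apply: (@continuous_comp _ _ _ set_val (proj i : {ptws I -> R} -> R)).
  exact: initial_continuous.
exact: proj_continuous.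
Qed.

Lemma continuous_axis_point (I : choiceType) (R : realType) (i : I) :
  continuous (axis_point i : R -> axes I R).
Proof.
apply: (@continuous_comp_initial (axes I R) R {ptws I -> R} set_val).
exact: (@dfwith_continuous I (fun=> R) (fun=> 0) i).
Qed.

(** The topology is induced by a uniform structure inherited from the product. *)
Lemma axes_completely_regular (I : choiceType) (R : realType) :
  completely_regular_space (axes I R).
Proof. move=> x B; exact: (@uniform_completely_regular R (axes I R)). Qed.

Lemma axes_hausdorff (I : choiceType) (R : realType) :
  hausdorff_space (axes I R).
Proof.
move=> x y xy; apply: coord_inj => i; apply: (@Rhausdorff R) => U V Ux Vy.
have [z [Uz Vz]] := xy _ _ (continuous_coord Ux) (continuous_coord Vy).
by exists (coord i z).
Qed.

Lemma origin_subproof (I : choiceType) (R : realType) :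
  ((fun=> 0) : {ptws I -> R}) \in axes I R.
Proof. by apply: mem_set => i j; rewrite eqxx. Qed.

Definition origin (I : choiceType) (R : realType) : axes I R :=
  exist (fun f => f \in axes I R) _ (origin_subproof I R).
Arguments origin : clear implicits.

Lemma coord_origin (I : choiceType) (R : realType) (i : I) :
  coord i (origin I R) = 0.
Proof. by []. Qed.

Lemma axis_point0 (I : choiceType) (R : realType) (i : I) :
  axis_point i 0 = origin I R.
Proof.
apply: coord_inj => j; have [<-|ij] := eqVneq i j.
  by rewrite coord_axis_point.
by rewrite coord_axis_pointN.
Qed.

Lemma neq_originP (I : choiceType) (R : realType) (x : axes I R) :
  x <> origin I R <-> exists i, coord i x != 0.
Proof.
split=> [xo|[i xi] xo]; last by move: xi; rewrite xo coord_origin eqxx.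
apply/not_existsP => x0; apply: xo; apply: coord_inj => i.
by rewrite coord_origin; apply/eqP/negPn/negP/x0.
Qed.

Lemma axes_connected (I : choiceType) (R : realType) :
  [set: I] !=set0 -> connected [set: axes I R].
Proof.
move=> [i0 _].
have -> : [set: axes I R] = \bigcup_i range (axis_point i).
  apply/seteqP; split=> // x _.
  have [->|/neq_originP[i xi]] := pselect (x = origin I R).
    by exists i0 => //; exists 0 => //; exact: axis_point0.
  by exists i => //; exists (coord i x) => //; rewrite -axis_pointE.
apply: bigcup_connected.
  by exists (origin I R) => i _; exists 0 => //; exact: axis_point0.
move=> i _; apply: connected_continuous_connected.
  by apply/connected_intervalP.
exact/continuous_subspaceT/continuous_axis_point.
Qed.

Lemma open_coord (I : choiceType) (R : realType) (i : I) (V : set R) :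
  open V -> open (coord i @^-1` V : set (axes I R)).
Proof. by apply: open_comp => x _; exact: continuous_coord. Qed.

(** A nonzero [i]-th coordinate forces all others to vanish, so this is the [i]-th axis without the
    origin, in a form that makes openness immediate. *)
Definition punctured_axis (I : choiceType) (R : realType) (i : I) :
  set (axes I R) := [set x | coord i x != 0].
Arguments punctured_axis : clear implicits.

Lemma open_punctured_axis (I : choiceType) (R : realType) (i : I) :
  open (punctured_axis I R i).
Proof.
have -> : punctured_axis I R i = coord i @^-1` (~` [set 0]).
  by apply/seteqP; split=> x /= /eqP.
apply: open_coord; apply: closed_openC.
exact/accessible_closed_set1/hausdorff_accessible/Rhausdorff.
Qed.

Lemma punctured_axis_nonempty (I : choiceType) (R : realType) (i : I) :
  punctured_axis I R i !=set0.
Proof.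
by exists (axis_point i 1); rewrite /punctured_axis /= coord_axis_point oner_eq0.
Qed.

Lemma punctured_axis_disjoint (I : choiceType) (R : realType) (i j : I) :
  i <> j -> punctured_axis I R j `&` punctured_axis I R i = set0.
Proof.
move=> /eqP ij; rewrite -subset0 => x [/= xj xi].
by move: xj; rewrite /punctured_axis /= (coord_neq0 xi ij) eqxx.
Qed.

Lemma bigcup_punctured_axis (I : choiceType) (R : realType) :
  ~` [set origin I R] = \bigcup_i punctured_axis I R i.
Proof.
apply/seteqP; split=> [x /neq_originP[i xi]|x [i _ xi]]; first by exists i.
by apply/neq_originP; exists i.
Qed.

(** The sets containing all but finitely many punctured axes form a filter [F], so its convergence
    to 0 can be tested one coordinate at a time. For coordinate [i] only the [i]-th axis can fail,
    the coordinate being 0 on all others. *)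
Lemma shrinking_punctured_axis (I : choiceType) (R : realType) :
  shrinking_to (punctured_axis I R) (origin I R).
Proof.
pose F : set_system {ptws I -> R} :=
  [set W | finite_set [set i | ~ punctured_axis I R i `<=` set_val @^-1` W]].
have FF : Filter F.
  split.
  - apply: (@sub_finite_set _ _ set0); last exact: finite_set0.
    by move=> i /=; case.
  - move=> P Q FP FQ; apply: (@sub_finite_set _ _ (_ `|` _)); last first.
      by rewrite finite_setU; split; [exact: FP|exact: FQ].
    move=> i /=; apply: contra_notP => /not_orP[/contrapT iP /contrapT iQ].
    by move=> x xi; split; [exact: iP|exact: iQ].
  - move=> P Q PQ; apply: sub_finite_set => i /=; apply: contra_not => iP x xi.
    exact/PQ/iP.
have Fo : F --> ((fun=> 0) : {ptws I -> R}).
  apply/cvg_sup => i W [_ [] [B oB <-] B0 BW].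
  apply: (@sub_finite_set _ _ [set i]); last exact: finite_set1.
  move=> j /=; apply: contra_notP => /eqP ji x xj; apply: BW => /=.
  by have /= := coord_neq0 xj ji; rewrite /coord => ->.
move=> W [_ [] [V oV <-] Vo VW].
have : F V by apply: Fo; exact: open_nbhs_nbhs.
apply: sub_finite_set => i /=; apply: contra_not => iV x xi.
exact/VW/iV.
Qed.

Lemma punctured_axis_locally_compact (I : choiceType) (R : realType) (i : I) :
  exists U C, [/\ open U, U (origin I R), compact C,
    punctured_axis I R i `&` U `<=` C &
    C `<=` punctured_axis I R i `|` [set origin I R]].
Proof.
(* A slab around the origin, and the closed segment of the [i]-th axis that contains its trace. *)
exists (coord i @^-1` `]-1, 1[), (axis_point i @` `[-1, 1]); split.
- by apply: open_coord; exact: interval_open.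
- by rewrite /= coord_origin in_itv /= ltrN10 ltr01.
- apply: continuous_compact; last exact: segment_compact.
  exact/continuous_subspaceT/continuous_axis_point.
- move=> x [/= xi x1]; exists (coord i x); last by rewrite -axis_pointE.
  exact: subset_itv_oo_cc.
- move=> _ [t _ <-]; have [->|t0] := eqVneq t 0; first by right; exact: axis_point0.
  by left; rewrite /punctured_axis /= coord_axis_point.
Qed.

Lemma axes_cut_point_space (I : choiceType) (R : realType) (i0 j0 : I) :
  i0 <> j0 -> cut_point_space (axes I R).
Proof.
move=> ij0; have cX : connected [set: axes I R].
  by apply: axes_connected; exists i0.
split=> // x; split=> // cx.
have [xo|/neq_originP[i xi]] := pselect (x = origin I R).
  have [y yj] := punctured_axis_nonempty R j0.
  suff E : punctured_axis I R i0 = ~` [set x].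
    have : (punctured_axis I R j0 `&` punctured_axis I R i0) y.
      by split=> //; rewrite E xo bigcup_punctured_axis; exists j0.
    by rewrite punctured_axis_disjoint.
  (* At the origin, the punctured axis [i0] is clopen in the complement: the other punctured axes
     have an open union. The axis [j0] shows that it is proper. *)
  apply: cx; first exact: punctured_axis_nonempty.
    exists (punctured_axis I R i0); first exact: open_punctured_axis.
    rewrite setIC; apply/esym/setIidPl.
    by rewrite xo bigcup_punctured_axis => z zi; exists i0.
  exists (~` \bigcup_(j in [set j | j <> i0]) punctured_axis I R j).
    by apply/open_closedC/bigcup_open => j _; exact: open_punctured_axis.
  rewrite xo bigcup_punctured_axis; apply/seteqP; split=> z.
    move=> zi; split; first by exists i0.
    move=> [j /= ji zj].
    have : (punctured_axis I R j `&` punctured_axis I R i0) z by [].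
    by rewrite punctured_axis_disjoint//; exact: not_eq_sym.
  move=> [[j _ zj] nz]; have [<-//|/eqP ji] := eqVneq j i0.
  by exfalso; apply: nz; exists j.
(* Because [coord i x] is nonzero, no other point shares it. Off [x], strict and weak inequality
   with [coord i x] therefore agree, which makes the set of points with larger [i]-th coordinate
   clopen there. *)
have coord_eq z : coord i z = coord i x -> z = x.
  by move=> zx; rewrite (axis_pointE xi) -zx -axis_pointE// zx.
suff /seteqP[_ /(_ (axis_point i (coord i x - 1)))] :
    [set z | coord i x < coord i z] = ~` [set x].
  rewrite /= coord_axis_point ltrBrDr gtrDl ltr10 => x1.
  have // : false by apply: x1 => /(congr1 (coord i)); rewrite coord_axis_point => /eqP;
    rewrite -subr_eq0 addrAC subrr sub0r oppr_eq0 oner_eq0.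
apply: cx.
- by exists (axis_point i (coord i x + 1)); rewrite /= coord_axis_point ltrDl.
- exists (coord i @^-1` `]coord i x, +oo[); first by apply: open_coord; exact: interval_open.
  apply/seteqP; split=> z; rewrite /= in_itv /= andbT; last by case.
  by move=> zx; split=> // zE; move: zx; rewrite zE ltxx.
- exists (~` (coord i @^-1` `]-oo, coord i x[)).
    by apply: open_closedC; apply: open_coord; exact: interval_open.
  apply/seteqP; split=> z; rewrite /= in_itv /=.
    move=> zx; split; last by apply/negP; rewrite -leNgt ltW.
    by move=> zE; move: zx; rewrite zE ltxx.
  move=> [zx /negP]; rewrite -leNgt le_eqVlt => /orP[/eqP xz|//].
  by case: zx; apply: coord_eq.
Qed.

(** * An uncountable index set, and the conclusion *)

Lemma uncountable_nat_bool : ~ countable [set: nat -> bool].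
Proof.
move=> /countable_injP[f finj].
(* Cantor's diagonal: at [n], [d] negates the value of the sequence coded by [n], and is
   false-proofed to [true] if there is none. The contradiction appears at [d]'s own code [f d]. *)
pose d n := ~~ `[< exists2 g, f g = n & g n >].
suff dE : d (f d) = ~~ d (f d) by case: (d (f d)) dE.
rewrite [LHS]/d; congr (~~ _); apply/asboolP/idP => [[g fg gd]|dd].
  by have gE : g = d by [apply: finj; rewrite ?inE|]; rewrite gE in gd.
by exists d.
Qed.

Theorem mainTheorem7 :
  exists (X : topologicalType) (x : X),
    [/\ tychonoff_space X, cut_point_space X &
        forall (K : topologicalType) (e : X -> K),
          compactification e -> cut_point (e x)].
Proof.
(* The index type has to be uncountable; the two constant sequences later serve as distinct axes. *)
pose I : choiceType := nat -> bool.
pose R : realType := Rdefinitions.R.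
exists (axes I R), (origin I R); split.
- by split; [exact: axes_completely_regular|exact: axes_hausdorff].
- apply: (@axes_cut_point_space I R (fun=> true) (fun=> false)).
  by move=> /(congr1 (@^~ 0%N)).
- move=> K e; apply: (@cut_point_compactification _ K I (punctured_axis I R)).
  + by apply: axes_connected; exists (fun=> true).
  + exact: uncountable_nat_bool.
  + exact: shrinking_punctured_axis.
  + exact: open_punctured_axis.
  + exact: punctured_axis_nonempty.
  + exact: punctured_axis_disjoint.
  + exact: bigcup_punctured_axis.
  + exact: punctured_axis_locally_compact.
Qed.
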